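(* Let $X$ be a real Hilbert space, let $f\colon X\to\,]-\infty,+\infty]$ be proper and lower semicontinuous such that there exist $\nu\in\mathbb R$, $\beta\in\mathbb R$, $\alpha\ge 0$ with $f(x)\ge -\alpha\|x\|^2-\beta\|x\|+\nu$ for all $x\in X$. Let $\lambda>0$ and $\mu\in\,]0,\lambda[$. Then the following are equivalent: (i) $f$ is $\tfrac1\lambda$-hypoconvex; (ii) $\mathrm{Id}-\operatorname{Prox}_{\mu f}$ is $\tfrac{\lambda}{2(\lambda-\mu)}$-conically nonexpansive; (iii) $\operatorname{Prox}_{\mu f}$ is $\tfrac{\lambda-\mu}{\lambda}$-cocoercive.
   Context: $\operatorname{Prox}_{\mu f}(x)=\operatorname{argmin}_{y\in X}\big(f(y)+\tfrac{1}{2\mu}\|x-y\|^2\big)$. $f$ is $\tfrac1\lambda$-hypoconvex if $f((1-\tau)x+\tau y)\le(1-\tau)f(x)+\tau f(y)+\tfrac{1}{2\lambda}\tau(1-\tau)\|x-y\|^2$ for all $x,y\in X$, $\tau\in]0,1[$. For $\gamma>0$, an operator $T\colon X\to X$ is $\gamma$-cocoercive if $\langle x-y,Tx-Ty\rangle\ge\gamma\|Tx-Ty\|^2$ for all $x,y$; for $\alpha>0$, $T$ is $\alpha$-conically nonexpansive if $T=(1-\alpha)\mathrm{Id}+\alpha N$ for some nonexpansive ($1$-Lipschitz) $N\colon X\to X$. *)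

(* Defs.v *)
From HB Require Import structures.
From mathcomp Require Import all_boot all_order all_algebra.
From mathcomp Require Import all_classical all_reals all_analysis.
Set Implicit Arguments. Unset Strict Implicit. Unset Printing Implicit Defensive.
Import Order.TTheory GRing.Theory Num.Theory.
Import numFieldNormedType.Exports.
Local Open Scope ring_scope.

Section Defs.
Context {R : realType} {X : normedModType R}.

Definition is_inner_product (ip : X -> X -> R) : Prop :=
  [/\ forall x y, ip x y = ip y x,
      forall a x y z, ip (a *: x + y) z = a * ip x z + ip y z,
      forall x, 0 <= ip x x &
      forall x, ip x x = `|x| ^+ 2].

Definition proper_fun (f : X -> \bar R) : Prop :=
  (forall x, f x != -oo%E) /\ (exists x, f x != +oo%E).

Definition is_prox (mu : R) (f : X -> \bar R) (x y : X) : Prop :=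
  forall z : X,
    (f y + (`|x - y| ^+ 2 / (2 * mu))%:E <= f z + (`|x - z| ^+ 2 / (2 * mu))%:E)%E.

Definition prox_operator (mu : R) (f : X -> \bar R) (T : X -> X) : Prop :=
  forall x y, is_prox mu f x y <-> y = T x.

Definition hypoconvex (lambda : R) (f : X -> \bar R) : Prop :=
  forall (x y : X) (tau : R), 0 < tau < 1 ->
    (f ((1 - tau) *: x + tau *: y)%R <=
       (1 - tau)%:E * f x + tau%:E * f y
       + ((1 / lambda) / 2 * tau * (1 - tau) * `|x - y| ^+ 2)%:E)%E.

Definition nonexpansive (N : X -> X) : Prop :=
  forall x y, `|N x - N y| <= `|x - y|.

Definition conically_nonexpansive (alpha : R) (T : X -> X) : Prop :=
  exists N : X -> X, nonexpansive N /\ forall x, T x = (1 - alpha) *: x + alpha *: N x.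

Definition cocoercive (ip : X -> X -> R) (gamma : R) (T : X -> X) : Prop :=
  forall x y, ip (x - y) (T x - T y) >= gamma * `|T x - T y| ^+ 2.

End Defs.

(* Main.v *)
(* Hypoconvexity makes z |-> f z + |x - z|^2 / (2 mu) strongly convex with modulus
   1 / mu - 1 / lambda, so it has a minimizer with quadratic growth; adding the growth
   inequalities at two points gives cocoercivity. Cocoercivity of T with constant
   g = (lambda - mu) / lambda is nonexpansiveness of Id - 2 g T, which is the conical
   condition.
   Conversely, let F = mu f + |.|^2 / 2. The conjugate phi of F has T as a subgradient
   selection, so cocoercivity makes phi (1/g)-smooth, whence
     F z >= F p + <u, z - p> + g / 2 |z - p|^2  for p = T u and all z.
   Given w on the segment [x, y], solve T u + e u = w: combining the inequality at x and
   y yields the wanted bound for F (T u), together with a bound on e |u|^2. So T u tends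
   to w as e tends to 0, and lower semicontinuity gives the bound at w. *)
Require Import Defs.
From HB Require Import structures.
From mathcomp Require Import all_boot all_order all_algebra.
From mathcomp Require Import all_classical all_reals all_analysis.
From mathcomp Require Import ring lra.
Import Order.TTheory GRing.Theory Num.Theory.
Import numFieldNormedType.Exports.
Local Open Scope ring_scope.

(** * Lower semicontinuity and minimizers of strongly convex functions *)

Section StrongConvexity.
Context {R : realType}.

(** Limit [t -> 0] in algebraic form; it recovers the full growth constant from inequalities along a
    segment. *)
Lemma ler_scale_lt1 (c d : R) :
  0 <= c -> (forall t, 0 < t < 1 -> c * (1 - t) <= d) -> c <= d.
Proof.
move=> c0 H; apply/ler_addgt0Pr => e e0.
have t01 : 0 < e / (c + e + 1) < 1.
  by rewrite divr_gt0 ?ltr_pdivrMr ?mul1r //=; lra.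
have := H _ t01.
suff : c * (e / (c + e + 1)) <= e by lra.
rewrite mulrCA ler_piMr ?ltW //.
by rewrite ltr_pdivrMr ?mul1r; lra.
Qed.

Lemma lower_semicontinuous_cvg (X : topologicalType) (f : X -> \bar R)
    (u : nat -> X) (r : nat -> R) (w : X) (l : R) :
  lower_semicontinuous f -> (u n @[n --> \oo] --> w)%classic ->
  (r n @[n --> \oo] --> l)%classic ->
  (forall n, (f (u n) <= (r n)%:E)%E) -> (f w <= l%:E)%E.
Proof.
move=> flsc uw rl fr; rewrite leNgt; apply/negP => lf.
have [e le ef] : exists2 e : R, l < e & (e%:E < f w)%E.
  case: (f w) lf => [b| |] //=.
  - rewrite lte_fin => lb; exists ((l + b) / 2); rewrite ?lte_fin; lra.
  - by move=> _; exists (l + 1); rewrite ?ltry //; lra.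
have [V nV fV] := flsc _ _ ef.
have Vu : (\forall n \near \oo, V (u n))%classic by exact: uw.
have [n [Vn rn]] := filter_ex (filterI Vu (cvgr_lt _ rl _ le)).
have := lt_le_trans (fV _ Vn) (fr n).
by rewrite lte_fin ltNge ltW.
Qed.

Lemma lower_semicontinuousD_fin (X : topologicalType) (f : X -> \bar R)
    (q : X -> R) :
  lower_semicontinuous f -> (forall x, f x != -oo%E) -> continuous q ->
  lower_semicontinuous (fun x => (f x + (q x)%:E)%E).
Proof.
move=> flsc fNy qc x a ax.
have [b bf ab] : exists2 b : R, (b%:E < f x)%E & a - b < q x.
  have := fNy x; case: (f x) ax => [r| |] //=.
  - rewrite -EFinD lte_fin => ar _; exists (r - (r + q x - a) / 2).
      by rewrite lte_fin; lra.
    lra.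
  - by move=> _ _; exists (a - q x + 1); rewrite ?ltry //; lra.
have [V nV fV] := flsc _ _ bf.
exists (V `&` [set y | a - b < q y])%classic.
  by apply: filterI => //; exact: cvgr_gt (qc x) _ ab.
move=> y [/fV bfy] /= aby.
have := fNy y; case: (f y) bfy => [r| |] //=.
  by rewrite -EFinD !lte_fin => ? _; lra.
by move=> _ _; rewrite addye // ltry.
Qed.

Context {X : completeNormedModType R}.

(** Real upper bounds [a], [b] replace the values of [h], so no arithmetic with infinite values
    arises. *)
Definition strongly_convex (s : R) (h : X -> \bar R) :=
  forall x y (a b t : R), 0 < t < 1 -> (h x <= a%:E)%E -> (h y <= b%:E)%E ->
    (h ((1 - t) *: x + t *: y)%R <=
      ((1 - t) * a + t * b - s / 2 * (t * (1 - t)) * `|x - y| ^+ 2)%:E)%E.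

Variables (s : R) (h : X -> \bar R).
Hypotheses (s0 : 0 < s) (hproper : proper_fun h)
  (hlsc : lower_semicontinuous h) (hconv : strongly_convex s h).

(** Lower semicontinuity bounds [h] below on a ball around [z0]. A far point [z] is compared with
    the point of the segment from [z0] to [z] that lies in this ball. *)
Lemma strongly_convex_bounded_below :
  exists m, forall z (r : R), (h z <= r%:E)%E -> m <= r.
Proof.
have [hNy [z0 hz0]] := hproper.
have [r0 hr0] : exists r0, h z0 = r0%:E.
  by have := hNy z0; case hr: (h z0) hz0 => [r| |] // _ _; exists r.
have [V] : exists2 V, nbhs z0 V & forall y, V y -> ((r0 - 1)%:E < h y)%E.
  by apply: hlsc; rewrite hr0 lte_fin; lra.
move=> /nbhs_ballP[d /= d0 dV] hV.
have {dV}{}hV y r : `|z0 - y| < d -> (h y <= r%:E)%E -> r0 - 1 < r.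
  move=> yd yr; rewrite -lte_fin; apply: lt_le_trans yr; apply: hV; apply: dV.
  by rewrite -ball_normE.
pose e := d / 2.
have e0 : 0 < e by rewrite divr_gt0.
(* At distance [rho] from [z0], convexity allows [h] to decrease by [rho / e]; [k]
   collects all terms linear in [rho], which the quadratic term absorbs. *)
pose k := e^-1 + s / 2 * e.
exists (r0 - 1 - k ^+ 2 / (2 * s)) => z r zr.
have k2 : 0 <= k ^+ 2 / (2 * s).
  by apply: divr_ge0; [exact: sqr_ge0 | rewrite mulr_ge0 // ltW].
have [/hV/(_ zr)|dz] := ltP `|z0 - z| d; first lra.
set rho := `|z0 - z| in dz.
have erho : e < rho by rewrite /e; lra.
have rho0 : 0 < rho by lra.
(* This weight puts the convex combination at distance [e = d / 2] from [z0]. *)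
pose t := e / rho.
have trho : t * rho = e by rewrite /t divfK ?gt_eqF.
have t01 : 0 < t < 1 by rewrite divr_gt0 //= ltr_pdivrMr ?mul1r.
have zle : (h z0 <= r0%:E)%E by rewrite hr0.
have := hconv z0 z r0 r t t01 zle zr.
move=> /hV; have -> : z0 - ((1 - t) *: z0 + t *: z) = t *: (z0 - z).
  by rewrite scalerBl scale1r scalerBr; rewrite opprD opprB addrA addrCA subrr addr0.
rewrite normrZ gtr0_norm; last by case/andP: t01.
rewrite -/rho trho => /(_ _)/wrap[]; first by rewrite /e; lra.
have -> : s / 2 * (t * (1 - t)) * rho ^+ 2 = s / 2 * e * (rho - e).
  by rewrite -trho; ring.
move=> H.
have {H}: t * (r0 - r) < 1 - s / 2 * e * (rho - e) by lra.
rewrite -(ltr_pM2l rho0) mulrA (mulrC rho) trho -(ltr_pM2l (_ : 0 < e^-1)) ?invr_gt0//.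
rewrite mulKf ?gt_eqF//.
have -> : e^-1 * (rho * (1 - s / 2 * e * (rho - e))) =
    e^-1 * rho - s / 2 * rho * (rho - e) by field; rewrite gt_eqF.
move=> H.
have : 0 <= (s * rho - k) ^+ 2 / (2 * s).
  by apply: divr_ge0; [exact: sqr_ge0 | rewrite mulr_ge0 // ltW].
have -> : (s * rho - k) ^+ 2 / (2 * s) = s / 2 * rho ^+ 2 - k * rho + k ^+ 2 / (2 * s).
  by field; rewrite gt_eqF.
move: H; rewrite /k; lra.
Qed.

Lemma strongly_convex_minimizer :
  exists p (m : R), h p = m%:E /\
    forall z (r : R), (h z <= r%:E)%E -> m + s / 2 * `|z - p| ^+ 2 <= r.
Proof.
have [hNy [z0 hz0]] := hproper.
have [lb hlb] := strongly_convex_bounded_below.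
pose S : set R := [set r : R | exists z, (h z <= r%:E)%E]%classic.
have Sinf : has_inf S.
  split; last by exists lb => r [z /hlb].
  have := hNy z0; case hr: (h z0) hz0 => [r| |] // _ _.
  by exists r, z0; rewrite hr.
pose m := inf S.
have mle z r : (h z <= r%:E)%E -> m <= r.
  by move=> zr; apply: ge_inf; [case: Sinf | exists z].
have /choice[u hu] n : exists z, (h z <= (m + harmonic n)%:E)%E.
  have [r [z zr] rm] := inf_adherent (harmonic_gt0 n) Sinf.
  by exists z; apply: le_trans zr _; rewrite lee_fin ltW.
(* Strong convexity at the midpoint, whose value is at least [m]: near-minimizers are close
   together, so [u] is a Cauchy sequence. *)
have close x y a b : (h x <= a%:E)%E -> (h y <= b%:E)%E ->
    s / 8 * `|x - y| ^+ 2 <= (a - m + (b - m)) / 2.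
  move=> xa yb; have := mle _ _ (hconv x y a b (1 / 2) _ xa yb).
  move=> /(_ _)/wrap[]; first by apply/andP; split; lra.
  lra.
have [p up] : exists p : X, (u n @[n --> \oo] --> p)%classic.
  apply/cvg_ex; apply/cauchy_cvgP; apply: cauchy_exP => e e0.
  have c0 : 0 < s / 8 * e ^+ 2 by rewrite mulr_gt0 ?exprn_gt0 ?divr_gt0.
  have [N _ HN] := near_infty_natSinv_lt (PosNum c0).
  exists (u N), N => // n /= Nn.
  rewrite -ball_normE /=.
  have := close _ _ _ _ (hu N) (hu n).
  have := HN _ Nn; have := HN _ (leqnn N); rewrite /harmonic /= => H1 H2 H3.
  have : s / 8 * `|u N - u n| ^+ 2 < s / 8 * e ^+ 2.
    move: H1 H2 H3; move: (N.+1%:R^-1) (n.+1%:R^-1) => a b; lra.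
  by rewrite ltr_pM2l ?divr_gt0// ltr_pXn2r ?nnegrE// ltW.
have hpm : (h p <= m%:E)%E.
  apply: lower_semicontinuous_cvg hlsc up _ hu.
  by rewrite -[X in (_ --> X)%classic]addr0; apply: cvgD;
    [exact: cvg_cst | exact: cvg_harmonic].
exists p, m; split.
  apply/eqP; rewrite eq_le hpm /=.
  have := hNy p; case E : (h p) => [r| |] // _; last by rewrite leey.
  by rewrite lee_fin; apply: (mle p); rewrite E.
move=> z r zr; rewrite addrC -lerBrDr.
(* Compare the minimum with the value at [(1 - t) *: p + t *: z], divide by [t], and let [t] tend to
   0. *)
apply: ler_scale_lt1 => [|t t01]; first by rewrite mulr_ge0 ?sqr_ge0// ltW ?divr_gt0.
have := mle _ _ (hconv p z m r t t01 hpm zr).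
rewrite (distrC z p) => H.
have {t01} /andP[t0 _] := t01.
rewrite -(ler_pM2l t0); lra.
Qed.
End StrongConvexity.

(** * Inner product identities and cocoercive operators *)

Section InnerProduct.
Context {R : realType} {X : normedModType R}.
Variables (ip : X -> X -> R).
Hypothesis hip : is_inner_product ip.
Implicit Types (x y z d : X) (t : R).

Lemma ipC x y : ip x y = ip y x. Proof. by case: hip. Qed.

Lemma ipDl x y z : ip (x + y) z = ip x z + ip y z.
Proof. by case: hip => _ /(_ 1 x y z) + _ _; rewrite scale1r mul1r. Qed.

Lemma ip0l z : ip 0 z = 0.
Proof. by have /eqP := ipDl 0 0 z; rewrite addr0 addrC -subr_eq subrr => /eqP. Qed.

Lemma ipZl a x z : ip (a *: x) z = a * ip x z.
Proof. by case: hip => _ /(_ a x 0 z) + _ _; rewrite addr0 ip0l addr0. Qed.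

Lemma ipNl x z : ip (- x) z = - ip x z.
Proof. by rewrite -scaleN1r ipZl mulN1r. Qed.

Lemma ipDr x y z : ip x (y + z) = ip x y + ip x z.
Proof. by rewrite ipC ipDl !(ipC x). Qed.

Lemma ipZr a x z : ip x (a *: z) = a * ip x z.
Proof. by rewrite ipC ipZl ipC. Qed.

Lemma ipNr x z : ip x (- z) = - ip x z.
Proof. by rewrite ipC ipNl ipC. Qed.

Lemma sqr_norm_ip x : `|x| ^+ 2 = ip x x. Proof. by case: hip. Qed.

Definition ipE := (sqr_norm_ip, ipDl, ipDr, ipNl, ipNr, ipZl, ipZr).

Lemma sqr_normB_convex x y z t :
  (1 - t) * `|x - z| ^+ 2 + t * `|y - z| ^+ 2 =
  `|(1 - t) *: x + t *: y - z| ^+ 2 + t * (1 - t) * `|x - y| ^+ 2.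
Proof. by rewrite !ipE (ipC z x) (ipC z y) (ipC y x); ring. Qed.

Lemma sqr_norm_convex x y t :
  `|(1 - t) *: x + t *: y| ^+ 2 =
  (1 - t) * `|x| ^+ 2 + t * `|y| ^+ 2 - t * (1 - t) * `|x - y| ^+ 2.
Proof. by rewrite !ipE (ipC y x); ring. Qed.

Section Cocoercive.
Variables (g : R) (T : X -> X).
Hypotheses (g0 : 0 < g) (Tco : cocoercive ip g T).

(** Expanding [|d - g t|^2 >= 0] and bounding [g^2 |t|^2] by cocoercivity takes the place of
    Cauchy-Schwarz. *)
Lemma cocoercive_ip_le x y : ip (x - y) (T x - T y) <= `|x - y| ^+ 2 / g.
Proof.
rewrite ler_pdivlMr //; have := Tco x y.
move: (x - y) (T x - T y) => d t dt.
have : 0 <= `|d - g *: t| ^+ 2 by rewrite sqr_ge0.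
move: dt; rewrite !ipE (ipC t d) => dt.
have := ler_wpM2l (ltW g0) dt; lra.
Qed.

(* Halving the segment [u, v] sends the constant [c] of a quadratic upper bound to
   [c / 2 + 1 / (4 g)], whose fixed point is [1 / (2 g)]. *)
Lemma cocoercive_subgradient_descent (phi : X -> R) :
  (forall u v, phi v + ip (u - v) (T v) <= phi u) ->
  forall u v, phi v <= phi u + ip (v - u) (T u) + `|v - u| ^+ 2 / (2 * g).
Proof.
move=> sub.
have step n : forall u v, phi v <= phi u + ip (v - u) (T u) +
    (1 + (1 / 2) ^+ n) * (`|v - u| ^+ 2 / (2 * g)).
  elim: n => [|n IHn] u v.
    (* The subgradient inequality at [v] gives the starting constant [1 / g], twice the target. *)
    have := sub u v; have := cocoercive_ip_le v u.
    have -> : (1 + (1 / 2) ^+ 0) * (`|v - u| ^+ 2 / (2 * g)) = `|v - u| ^+ 2 / g.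
      by rewrite expr0; field; rewrite gt_eqF.
    rewrite -(opprB v u) ipNl ipDr ipNr; lra.
  pose m := u + 2^-1 *: (v - u).
  have mu : m - u = 2^-1 *: (v - u) by rewrite /m addrAC subrr add0r.
  have vm : v - m = 2^-1 *: (v - u).
    rewrite /m opprD addrA -{1}[v - u]scale1r -scalerBl.
    by congr (_ *: _); lra.
  have := IHn m v; have := IHn u m; have := cocoercive_ip_le m u.
  rewrite mu vm !ipZl normrZ ger0_norm// exprMn ipDr ipNr (exprS _ n).
  move: (`|v - u| ^+ 2) => D.
  have -> : 2^-1 ^+ 2 * D / g = D / (2 * g) / 2 by field; rewrite gt_eqF.
  have -> : 2^-1 ^+ 2 * D / (2 * g) = D / (2 * g) / 4 by field; rewrite gt_eqF.
  lra.
move=> u v; apply/ler_addgt0Pr => e e0.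
have q1 : `|1 / 2 : R| < 1 by rewrite ger0_norm; lra.
have cv := cvg_geometric (`|v - u| ^+ 2 / (2 * g)) q1.
have [n] := filter_ex (cvgr_lt _ cv _ e0).
rewrite /geometric /= => ne.
have := step n u v; lra.
Qed.

(** The step size makes the vector a multiple of [d - g *: t], which cocoercivity makes no longer
    than [d]. *)
Lemma cocoercive_sqr_norm_le (e : R) d (t : X) : 0 < e -> g * `|t| ^+ 2 <= ip d t ->
  `|d - (g / (1 + g * e)) *: (t + e *: d)| ^+ 2 <= ((1 + g * e)^-1 * `|d|) ^+ 2.
Proof.
move=> e0 dt.
pose k := (1 + g * e)^-1.
have ge1 : 0 < 1 + g * e by rewrite addr_gt0 ?mulr_gt0.
have k0 : 0 < k by rewrite invr_gt0.
have -> : d - (g / (1 + g * e)) *: (t + e *: d) = k *: (d - g *: t).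
  rewrite scalerDr [RHS]scalerBr !scalerA.
  have -> : k *: d = d - (g / (1 + g * e) * e) *: d.
    rewrite -[X in _ = X - _]scale1r -scalerBl; congr (_ *: _).
    by rewrite /k; field; rewrite gt_eqF.
  by rewrite opprD addrA addrAC (mulrC g).
rewrite normrZ (gtr0_norm k0) !exprMn ler_pM2l ?exprn_gt0//.
move: dt; rewrite !ipE (ipC t d) => dt.
have := ler_wpM2l (ltW g0) dt.
have : 0 <= g * (g * ip t t) by rewrite -sqr_norm_ip !mulr_ge0 ?sqr_ge0 // ltW.
lra.
Qed.

End Cocoercive.
End InnerProduct.

(** Solutions are the fixed points of the damped iteration [L], a contraction with factor
    [1 / (1 + g e)]. *)
Lemma cocoercive_resolvent {R : realType} {X : completeNormedModType R}
    (ip : X -> X -> R) (g e : R) (T : X -> X) (w : X) :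
  is_inner_product ip -> 0 < g -> cocoercive ip g T -> 0 < e ->
  exists u, T u + e *: u = w.
Proof.
move=> hip g0 Tco e0.
pose k := g / (1 + g * e).
have ge1 : 0 < 1 + g * e by rewrite addr_gt0 ?mulr_gt0.
have k0 : 0 < k by rewrite divr_gt0.
pose L u := u - k *: (T u + e *: u - w).
have Lfun : set_fun [set: X]%classic [set: X]%classic L by [].
pose L' : {fun [set: X]%classic >-> [set: X]%classic} :=
  HB.pack L (isFun.Build _ _ _ _ L Lfun).
have q0 : 0 <= (1 + g * e)^-1 by rewrite invr_ge0 ltW.
have ctr : is_contraction L'.
  exists (NngNum q0); split => /=; first by rewrite invf_lt1 // ltrDl mulr_gt0.
  move=> [x y] _.
  have Lxy : `|L x - L y| <= (1 + g * e)^-1 * `|x - y|; last exact: Lxy.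
  have -> : L x - L y = (x - y) - k *: ((T x - T y) + e *: (x - y)).
    have -> : T x - T y + e *: (x - y) =
        (T x + e *: x - w) - (T y + e *: y - w).
      by rewrite opprB addrA subrK opprD addrACA scalerBr.
    by rewrite /L [in RHS]scalerBr opprD addrACA -opprD.
  rewrite -ler_sqr ?nnegrE ?mulr_ge0//.
  by apply: cocoercive_sqr_norm_le => //; exact: hip.
have [u _ /esym/eqP] := banach_fixed_point ctr closedT (ex_intro _ 0 I).
rewrite /= /L -subr_eq0 addrAC subrr add0r oppr_eq0 scaler_eq0 gt_eqF //= subr_eq0.
by move/eqP; exists u.
Qed.

(** * From hypoconvexity to the proximal operator and its cocoercivity *)

Section Prox.
Context {R : realType} {X : completeNormedModType R}.
Variables (ip : X -> X -> R) (f : X -> \bar R) (lambda mu : R).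
Hypotheses (hip : is_inner_product ip) (fproper : proper_fun f)
  (flsc : lower_semicontinuous f) (lambda0 : 0 < lambda) (mu0 : 0 < mu)
  (mulambda : mu < lambda).

Let f_fin x (r : R) : (f x <= r%:E)%E -> exists2 a : R, f x = a%:E & a <= r.
Proof.
have := fproper.1 x; case: (f x) => [a| |] // _.
by rewrite lee_fin; exists a.
Qed.

(** Both weights are positive, so an infinite value at [x] or [y] makes the right-hand side
    infinite. *)
Lemma hypoconvex_finP :
  hypoconvex lambda f <-> forall x y (a b t : R), 0 < t < 1 ->
    (f x <= a%:E)%E -> (f y <= b%:E)%E ->
    (f ((1 - t) *: x + t *: y)%R <= ((1 - t) * a + t * b +
       (1 / lambda) / 2 * t * (1 - t) * `|x - y| ^+ 2)%:E)%E.
Proof.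
split=> [hf x y a b t t01 fa fb | hf x y t t01].
  apply: le_trans (hf x y t t01) _.
  rewrite (EFinD (_ + _)) (EFinD (_ * a)) (EFinM (1 - t)) (EFinM t b).
  have /andP[t0 t1] := t01.
  by rewrite leeD2r // leeD // lee_wpmul2l // lee_fin; lra.
have /andP[t0 t1] := t01; have t1' : 0 < 1 - t by lra.
have [fx fy] := (fproper.1 x, fproper.1 y).
case fxE : (f x) fx => [a| |] // _; case fyE : (f y) fy => [b| |] // _.
- by apply: hf; rewrite ?fxE ?fyE.
- by rewrite gt0_muley ?lte_fin // leey.
- by rewrite gt0_muley ?lte_fin // leey.
- by rewrite !gt0_muley ?lte_fin // leey.
Qed.

Let q (x z : X) : R := `|x - z| ^+ 2 / (2 * mu).

Let leeD_q x z (r : R) :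
  (f z + (q x z)%:E <= r%:E)%E = (f z <= (r - q x z)%:E)%E.
Proof.
have := fproper.1 z; case: (f z) => [a| |] // _; first by rewrite !lee_fin lerBrDr.
Qed.

(** The quadratic penalty is strongly convex with modulus [1 / mu], with equality; hypoconvexity
    costs [1 / lambda]. *)
Lemma hypoconvex_prox_objective_strongly_convex x : hypoconvex lambda f ->
  strongly_convex (mu^-1 - lambda^-1) (fun z => (f z + (q x z)%:E)%E).
Proof.
move=> /hypoconvex_finP hf y z a b t t01; rewrite !leeD_q => ya zb.
apply: le_trans (hf _ _ _ _ _ t01 ya zb) _; rewrite lee_fin /q.
have := sqr_normB_convex ip hip y z x t; rewrite ![`|_ - x|]distrC => E.
have -> : `|x - ((1 - t) *: y + t *: z)| ^+ 2 = (1 - t) * `|x - y| ^+ 2 +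
  t * `|x - z| ^+ 2 - t * (1 - t) * `|y - z| ^+ 2 by lra.
rewrite le_eqVlt; apply/orP; left; apply/eqP.
by field; rewrite !gt_eqF.
Qed.

Lemma hypoconvex_prox_cocoercive : hypoconvex lambda f ->
  exists T : X -> X, prox_operator mu f T /\
    cocoercive ip ((lambda - mu) / lambda) T.
Proof.
move=> hf; pose s := mu^-1 - lambda^-1.
have s0 : 0 < s by rewrite subr_gt0 ltf_pV2.
have min x : exists p, exists2 m : R, (f p + (q x p)%:E)%E = m%:E &
    forall z (r : R), (f z + (q x z)%:E <= r%:E)%E -> m + s / 2 * `|z - p| ^+ 2 <= r.
  have [|||p [m [pm hm]]] := @strongly_convex_minimizer R X s
      (fun z => (f z + (q x z)%:E)%E) s0; last by exists p, m.
  - split=> [z|].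
      by have := fproper.1 z; case: (f z).
    by have [z fz] := fproper.2; exists z; move: fz; case: (f z).
  - apply: lower_semicontinuousD_fin => //; first exact: fproper.1.
    move=> z; apply: cvgM; last exact: cvg_cst.
    have d : ((`|x - z'| : R) @[z' --> z] --> `|x - z|)%classic.
      by apply: cvg_norm; apply: cvgB; [exact: cvg_cst | exact: cvg_id].
    exact: (cvgM d d).
  - exact: hypoconvex_prox_objective_strongly_convex.
have {min} /choice[T hT] := min.
exists T; split.
  move=> x y; have [m pm hm] := hT x; split=> [yprox|->].
    (* Another proximal point also attains the minimum, so quadratic growth forces it to be
       [T x]. *)
    have := hm y m; rewrite -[X in (_ <= X)%E -> _]pm => /(_ (yprox (T x))) H.
    have : `|y - T x| ^+ 2 <= 0 by rewrite -(ler_pM2l s0); lra.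
    by rewrite le_eqVlt ltNge sqr_ge0 orbF sqrf_eq0 normr_eq0 subr_eq0 => /eqP.
  move=> z; rewrite -/(q x (T x)) -/(q x z) pm.
  case E : (f z + (q x z)%:E)%E => [r| |]; last 2 first.
  - by rewrite leey.
  - by have := fproper.1 z; move: E; case: (f z).
  have := hm z r; rewrite E lexx => /(_ isT) H; rewrite lee_fin.
  by apply: le_trans H; rewrite lerDl mulr_ge0 ?sqr_ge0 // divr_ge0 // ltW.
move=> x y.
have [m pm hm] := hT x; have [n pn hn] := hT y.
have [] := f_fin (T x) (m - q x (T x)) _; first by rewrite -leeD_q pm.
move=> a fa _; have [] := f_fin (T y) (n - q y (T y)) _; first by rewrite -leeD_q pn.
move=> b fb _.
have {pm} pm : a + q x (T x) = m by apply: EFin_inj; rewrite -pm fa.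
have {pn} pn : b + q y (T y) = n by apply: EFin_inj; rewrite -pn fb.
(* Growth of the objective of [x] at [T y] and of that of [y] at [T x]; in the sum the values of [f]
   cancel. *)
have {hm} := hm (T y) (b + q x (T y)).
have {hn} := hn (T x) (a + q y (T x)).
rewrite fa fb -!EFinD !lexx => /(_ isT) + /(_ isT).
rewrite -pm -pn (distrC (T y)).
have -> : q x (T x) = `|x - T x| ^+ 2 / (2 * mu) by [].
rewrite /q.
have E : `|x - T y| ^+ 2 + `|y - T x| ^+ 2 - `|x - T x| ^+ 2 - `|y - T y| ^+ 2 =
    2 * ip (x - y) (T x - T y).
  rewrite !(ipE ip hip) (ipC ip hip (T x) x) (ipC ip hip (T x) y).
  by rewrite (ipC ip hip (T y) x) (ipC ip hip (T y) y); ring.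
move=> H1 H2; 
have -> : ((lambda - mu) / lambda) = mu * s by rewrite /s; field; rewrite !gt_eqF.
rewrite -mulrA -(ler_pM2l (_ : 0 < mu^-1)) ?invr_gt0// mulKf ?gt_eqF//.
have -> : mu^-1 * ip (x - y) (T x - T y) = (2 * ip (x - y) (T x - T y)) / (2 * mu).
  by field; rewrite gt_eqF.
rewrite -E; lra.
Qed.

Lemma cocoercive_conically_nonexpansive (T : X -> X) :
  cocoercive ip ((lambda - mu) / lambda) T <->
  conically_nonexpansive (lambda / (2 * (lambda - mu))) (fun x => x - T x).
Proof.
pose g := (lambda - mu) / lambda.
have lm0 : 0 < lambda - mu by rewrite subr_gt0.
have g0 : 0 < g by rewrite divr_gt0.
have -> : lambda / (2 * (lambda - mu)) = (2 * g)^-1.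
  by rewrite /g; field; rewrite !gt_eqF.
have g20 : 2 * g != 0 by rewrite gt_eqF // mulr_gt0.
pose N x := x - (2 * g) *: T x.
have coN : cocoercive ip g T <-> nonexpansive N.
  have E x y : `|N x - N y| ^+ 2 = `|x - y| ^+ 2 -
      4 * g * (ip (x - y) (T x - T y) - g * `|T x - T y| ^+ 2).
    have -> : N x - N y = (x - y) - (2 * g) *: (T x - T y).
      by rewrite /N scalerBr opprD addrACA -opprD.
    move: (x - y) (T x - T y) => d t.
    by rewrite !(ipE ip hip) (ipC ip hip t d); ring.
  split=> H x y; have := H x y.
    move=> {}H; rewrite -ler_sqr ?nnegrE // E.
    by rewrite gerBl mulr_ge0 ?subr_ge0 // mulr_ge0 // ltW.
  by rewrite -ler_sqr ?nnegrE // E gerBl pmulr_rge0 ?subr_ge0 // mulr_gt0.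
have TN x : x - T x = (1 - (2 * g)^-1) *: x + (2 * g)^-1 *: N x.
  rewrite /N scalerBr scalerA mulVf // scale1r addrA -scalerDl.
  by rewrite subrK scale1r.
split=> [/coN Nne | [M [Mne TM]]]; first by exists N.
apply/coN; suff -> : N = M by [].
(* The factor [(2 * g)^-1] is nonzero, so [T] determines the nonexpansive part. *)
apply/funext => x; have := TM x; rewrite TN => /addrI.
by apply: scalerI; rewrite invr_eq0.
Qed.

(** * From a cocoercive proximal operator back to hypoconvexity *)

Section ProxOperator.
Variable T : X -> X.
Hypothesis Tprox : prox_operator mu f T.

Let prox_fin x : exists a : R, f (T x) = a%:E.
Proof.
have [z fz] := fproper.2.
have := (Tprox x (T x)).2 erefl z.
have := fproper.1 (T x); case: (f (T x)) => [a| |] // _; first by exists a.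
by rewrite addye //; case: (f z) fz.
Qed.

Let F x : R := fine (f (T x)).

Let FE x : f (T x) = (F x)%:E.
Proof. by rewrite /F; have [a ->] := prox_fin x. Qed.

(* the conjugate of [mu f + |.|^2 / 2], with [T] as a subgradient selection *)
Let phi x := ip x (T x) - mu * F x - `|T x| ^+ 2 / 2.

(** Fenchel-Young inequality: minimality of [T x] multiplied by [mu], where the terms in [|x|^2]
    cancel. *)
Let conjugate_ge x z (r : R) : (f z <= r%:E)%E ->
  ip x z - mu * r - `|z| ^+ 2 / 2 <= phi x.
Proof.
move=> fz; have H : F x + `|x - T x| ^+ 2 / (2 * mu) <= r + `|x - z| ^+ 2 / (2 * mu).
  rewrite -lee_fin EFinD -FE; apply: le_trans ((Tprox x (T x)).2 erefl z) _.
  by rewrite EFinD leeD2r.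
have : mu * (F x + `|x - T x| ^+ 2 / (2 * mu)) <= mu * (r + `|x - z| ^+ 2 / (2 * mu)).
  by rewrite ler_pM2l.
have E c y : mu * (c + `|x - y| ^+ 2 / (2 * mu)) =
    mu * c + `|y| ^+ 2 / 2 + `|x| ^+ 2 / 2 - ip x y.
  by rewrite !(ipE ip hip) (ipC ip hip y x); field; rewrite gt_eqF.
rewrite !E /phi; lra.
Qed.

(** At a suitable [v], Fenchel-Young bounds [phi v] below and the descent bound from [u] bounds it
    above. *)
Lemma cocoercive_prox_growth g u z (r : R) : 0 < g -> cocoercive ip g T ->
  (f z <= r%:E)%E ->
  mu * fine (f (T u)) + `|T u| ^+ 2 / 2 + ip u (z - T u) + g / 2 * `|z - T u| ^+ 2
  <= mu * r + `|z| ^+ 2 / 2.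
Proof.
move=> g0 Tco fz; rewrite -/(F u).
have sub x y : phi y + ip (x - y) (T y) <= phi x.
  have := conjugate_ge x (T y) (F y); rewrite FE lexx => /(_ isT).
  by rewrite /phi (ipDl ip hip) (ipNl ip hip); lra.
(* the point at which the Young inequality for the quadratic bound is sharp *)
pose v := u + g *: (z - T u).
have vu : v - u = g *: (z - T u) by rewrite /v addrAC subrr add0r.
have := cocoercive_subgradient_descent ip hip g T g0 Tco phi sub u v.
have := conjugate_ge v z r fz; rewrite vu normrZ gtr0_norm // exprMn.
have -> : g ^+ 2 * `|z - T u| ^+ 2 / (2 * g) = g / 2 * `|z - T u| ^+ 2.
  by field; rewrite gt_eqF.
rewrite /v /phi !(ipE ip hip) (ipC ip hip (T u) z); lra.
Qed.

Lemma cocoercive_prox_hypoconvex :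
  cocoercive ip ((lambda - mu) / lambda) T -> hypoconvex lambda f.
Proof.
set g := (lambda - mu) / lambda => Tco.
have g0 : 0 < g by rewrite divr_gt0 // subr_gt0.
apply/hypoconvex_finP => x y a b t t01 fa fb.
have /andP[t0 t1] := t01; have t1' : 0 < 1 - t by rewrite subr_gt0.
set w := (1 - t) *: x + t *: y.
pose K := (1 - t) * (mu * a + `|x| ^+ 2 / 2) + t * (mu * b + `|y| ^+ 2 / 2)
  - g / 2 * (t * (1 - t) * `|x - y| ^+ 2).
(* The growth inequality at [u = 0] has no linear term, so [m] is a lower bound on the range of
   [T]. *)
pose m := mu * F 0 + `|T 0| ^+ 2 / 2.
have mle u : m <= mu * F u + `|T u| ^+ 2 / 2.
  have := cocoercive_prox_growth g 0 (T u) (F u) g0 Tco.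
  rewrite FE lexx -/(F 0) (ip0l ip hip) => /(_ isT); rewrite -/m.
  have : 0 <= g / 2 * `|T u - T 0| ^+ 2 by rewrite mulr_ge0 ?sqr_ge0 // divr_ge0 // ltW.
  lra.
have key e u : 0 < e -> T u + e *: u = w ->
    mu * F u + `|T u| ^+ 2 / 2 + e * `|u| ^+ 2 <= K.
  move=> e0 uw.
  have := ler_wpM2l (ltW t1') (cocoercive_prox_growth g u x a g0 Tco fa).
  have := ler_wpM2l (ltW t0) (cocoercive_prox_growth g u y b g0 Tco fb).
  rewrite -/(F u).
  (* The averaged linear terms form [ip u (w - T u)], and [w - T u = e *: u]. *)
  have E : (1 - t) * ip u (x - T u) + t * ip u (y - T u) = e * `|u| ^+ 2.
    have -> : e * `|u| ^+ 2 = ip u (w - T u).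
      by rewrite -uw addrAC subrr add0r (ipZr ip hip) (sqr_norm_ip ip hip).
    by rewrite /w !(ipE ip hip); ring.
  have := sqr_normB_convex ip hip x y (T u) t; rewrite -/w => E2.
  have : 0 <= g / 2 * `|w - T u| ^+ 2 by rewrite mulr_ge0 ?sqr_ge0 // divr_ge0 // ltW.
  have : g / 2 * ((1 - t) * `|x - T u| ^+ 2 + t * `|y - T u| ^+ 2) =
    g / 2 * (`|w - T u| ^+ 2 + t * (1 - t) * `|x - y| ^+ 2) by rewrite E2.
  rewrite /K; move: E; lra.
have /choice[u hu] n : exists u, T u + harmonic n *: u = w.
  by apply: (cocoercive_resolvent ip g) => //; exact: harmonic_gt0.
have Tuw : (T (u n) @[n --> \oo] --> w)%classic.
  apply/cvgrPdist_lt => e e0.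
  (* With [e] the n-th harmonic term, [|w - T u|^2 = e^2 |u|^2 <= e (K - m)]. *)
  have cv : ((K - m) * harmonic n @[n --> \oo] --> (0 : R))%classic.
    by rewrite -(mulr0 (K - m)); apply: cvgM; [exact: cvg_cst | exact: cvg_harmonic].
  have e20 : 0 < e ^+ 2 by rewrite exprn_gt0.
  apply: filterS (cvgr_lt _ cv _ e20) => n ne.
  rewrite -ltr_sqr ?nnegrE // ?(ltW e0) //.
  apply: le_lt_trans ne.
  have := key _ _ (harmonic_gt0 n) (hu n); have := mle (u n) => H1 H2.
  rewrite -{1}(hu n) addrAC subrr add0r normrZ gtr0_norm ?harmonic_gt0 //.
  rewrite exprMn expr2 -mulrA mulrC ler_pM2r ?harmonic_gt0 //; lra.
pose r n := (K - `|T (u n)| ^+ 2 / 2) / mu.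
have rl : (r n @[n --> \oo] --> (K - `|w| ^+ 2 / 2) / mu)%classic.
  apply: cvgM; last exact: cvg_cst.
  apply: cvgB; first exact: cvg_cst.
  apply: cvgM; last exact: cvg_cst.
  exact: (cvgM (cvg_norm Tuw) (cvg_norm Tuw)).
have fr n : (f (T (u n)) <= (r n)%:E)%E.
  rewrite FE lee_fin /r ler_pdivlMr // mulrC.
  have := key _ _ (harmonic_gt0 n) (hu n).
  have : 0 <= harmonic n * `|u n| ^+ 2 by rewrite mulr_ge0 ?sqr_ge0 // ltW ?harmonic_gt0.
  lra.
have := lower_semicontinuous_cvg _ f _ r w _ flsc Tuw rl fr.
(* Expanding [|w|^2] leaves the coefficient [(1 - g) / (2 mu) = 1 / (2 lambda)] on
   [t (1 - t) |x - y|^2]. *)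
congr (_ <= _%:E)%E; rewrite (sqr_norm_convex ip hip) /K /g.
by field; rewrite !gt_eqF.
Qed.
End ProxOperator.
End Prox.

Theorem theorem6p4 (R : realType) (X : completeNormedModType R)
  (ip : X -> X -> R) (f : X -> \bar R) (nu beta alpha lambda mu : R) :
  is_inner_product ip ->
  proper_fun f ->
  lower_semicontinuous f ->
  0 <= alpha ->
  (forall x : X, ((- alpha * `|x| ^+ 2 - beta * `|x| + nu)%:E <= f x)%E) ->
  0 < lambda -> 0 < mu < lambda ->
  [<-> hypoconvex lambda f;
       exists T : X -> X, prox_operator mu f T /\
         conically_nonexpansive (lambda / (2 * (lambda - mu))) (fun x => x - T x);
       exists T : X -> X, prox_operator mu f T /\
         cocoercive ip ((lambda - mu) / lambda) T].
Proof.
move=> hip fproper flsc _ _ lambda0 /andP[mu0 mulambda].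
have equiv := cocoercive_conically_nonexpansive ip lambda mu hip lambda0 mulambda.
tfae.
- move=> hf.
  have [T [Tprox Tco]] := hypoconvex_prox_cocoercive ip f lambda mu
    hip fproper flsc lambda0 mu0 mulambda hf.
  by exists T; split => //; apply/equiv.
- by move=> [T [Tprox Tcn]]; exists T; split => //; apply/equiv.
- move=> [T [Tprox Tco]].
  exact: (cocoercive_prox_hypoconvex ip f lambda mu).
Qed.
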